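(* Let $x_k$, $r_k$ be the iterate and recurred residual after $k$ iterations of the inexact CG algorithm (with perturbation matrices $E_0,\dots,E_{k-1}$) applied to $A$ and $b$. Let $\epsilon>0$ and let $\phi=(\phi_1,\dots,\phi_k)\in\mathbb{R}^k$ be a vector with positive entries satisfying $$\sum_{j=1}^{k}\frac{1}{\phi_j}\le 1 .$$ Suppose furthermore that, for all $j\in\{0,\dots,k-1\}$, $$\|E_j\|_{A^{-1},A}\le \omega_j := \frac{\sqrt{\epsilon}\,\|b\|_{A^{-1}}\|p_j\|_A}{2\,\phi_{j+1}\|r_j\|_2^2+\sqrt{\epsilon}\,\|b\|_{A^{-1}}\|p_j\|_A}.$$ Then $$\|r(x_k)-r_k\|_{A^{-1}}\le \frac{\sqrt{\epsilon}}{2}\|b\|_{A^{-1}}.$$ If additionally $\|r_k\|_{A^{-1}}\le \frac{\sqrt{\epsilon}}{2}\|b\|_{A^{-1}}$, then both $$\max\big[\|r(x_k)-r_k\|_{A^{-1}},\ \|r_k\|_{A^{-1}}\big]\le\frac{\sqrt{\epsilon}}{2}\|b\|_{A^{-1}}\quad\text{and}\quad |q(x_k)-q(x_* )|\le \epsilon\,|q(x_* )|$$ hold.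
   Context: $A\in\mathbb{R}^{n\times n}$ is symmetric positive definite, $b\in\mathbb{R}^n$, $q(x)=\frac12 x^TAx-b^Tx$, $x_*=A^{-1}b$ (the minimizer of $q$), and $r(x)=Ax-b$. For symmetric positive definite $M$, $\|x\|_M=\|M^{1/2}x\|_2$. For $E\in\mathbb{R}^{n\times n}$, $\|E\|_{A^{-1},A}=\sup_{x\neq0}\|Ex\|_{A^{-1}}/\|x\|_A=\|A^{-1/2}EA^{-1/2}\|_2$. Inexact CG algorithm (in exact arithmetic): set $x_0=0$, $\beta_0=\|b\|_2^2$, $r_0=-b$, $p_0=b$. For $j=0,1,\dots$, with a perturbation matrix $E_j\in\mathbb{R}^{n\times n}$: $c_j=(A+E_j)p_j$, $\alpha_j=\beta_j/(p_j^Tc_j)$, $x_{j+1}=x_j+\alpha_jp_j$, $r_{j+1}=r_j+\alpha_jc_j$, $\beta_{j+1}=r_{j+1}^Tr_{j+1}$, $p_{j+1}=-r_{j+1}+(\beta_{j+1}/\beta_j)p_j$. It is understood that the first $k$ iterations are carried out, i.e. the algorithm has not stopped before and $\beta_j\neq0$ and $p_j^Tc_j\ne0$ for $0\le j\le k-1$. The recurred residual $r_j$ need not equal the true residual $r(x_j)$. *)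

(* Defs.v *)
From mathcomp Require Export all_boot all_order all_algebra.
From mathcomp Require Export boolp classical_sets reals.

Set Implicit Arguments.
Unset Strict Implicit.
Unset Printing Implicit Defensive.

Import Order.TTheory GRing.Theory Num.Theory.
Local Open Scope classical_set_scope.
Local Open Scope ring_scope.

Section VectorsAndNorms.
Context {R : realType} {n : nat}.
Implicit Types (M N E S : 'M[R]_n) (u v x : 'cV[R]_n).

Definition dotv u v : R := (u^T *m v) 0 0.

(* The norm that MathComp-Analysis puts on matrices is the sup norm. *)
Definition norm2 x : R := Num.sqrt (dotv x x).

Definition spd M : Prop :=
  M^T = M /\ forall x, x != 0 -> 0 < dotv x (M *m x).

(* For symmetric positive definite M exactly one S satisfies the condition
   below; the default value 0 is only returned when there is none. *)
Definition sqrtmx M : 'M[R]_n := xget 0 [set S | spd S /\ S *m S = M].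

Definition wnorm M x : R := norm2 (sqrtmx M *m x).

(* opnorm N M E is ||E||_{N,M}: M weighs the argument, N the value.
   The set is bounded when M is symmetric positive definite, so this is a true
   supremum; for n = 0 the set is empty and sup set0 = 0. *)
Definition opnorm N M E : R :=
  sup [set wnorm N (E *m x) / wnorm M x | x in [set x | x != 0]].

End VectorsAndNorms.

Section InexactCG.
Context {R : realType} {n : nat}.
Variables (A : 'M[R]_n) (b : 'cV[R]_n).

Definition quad (x : 'cV[R]_n) : R := 2^-1 * dotv x (A *m x) - dotv b x.

Definition xstar : 'cV[R]_n := invmx A *m b.

Definition residual (x : 'cV[R]_n) : 'cV[R]_n := A *m x - b.

Record cg_state := CGState {
  cg_x : 'cV[R]_n;
  cg_r : 'cV[R]_n;
  cg_p : 'cV[R]_n;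
  cg_beta : R
}.

Definition cg_init : cg_state := CGState 0 (- b) b (norm2 b ^+ 2).

Definition cg_c (Ej : 'M[R]_n) (s : cg_state) : 'cV[R]_n :=
  (A + Ej) *m cg_p s.

(* Division by zero yields 0 here, so a step is meaningful only when
   cg_beta s and dotv (cg_p s) (cg_c Ej s) are nonzero; see cg_runs. *)
Definition cg_step (Ej : 'M[R]_n) (s : cg_state) : cg_state :=
  let c := cg_c Ej s in
  let alpha := cg_beta s / dotv (cg_p s) c in
  let r' := cg_r s + alpha *: c in
  let beta' := dotv r' r' in
  CGState (cg_x s + alpha *: cg_p s) r'
          (- r' + (beta' / cg_beta s) *: cg_p s) beta'.

Fixpoint icg (E : nat -> 'M[R]_n) (j : nat) : cg_state :=
  if j is i.+1 then cg_step (E i) (icg E i) else cg_init.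

(* The first k iterations can be carried out. *)
Definition cg_runs (E : nat -> 'M[R]_n) (k : nat) : Prop :=
  forall j, (j < k)%N ->
    cg_beta (icg E j) != 0 /\
    dotv (cg_p (icg E j)) (cg_c (E j) (icg E j)) != 0.

(* The bound omega_j, with phi_j standing for phi_{j+1} and s for the state
   (x_j, r_j, p_j, beta_j). *)
Definition omega (eps phi_j : R) (s : cg_state) : R :=
  let t := Num.sqrt eps * wnorm (invmx A) b * wnorm A (cg_p s) in
  t / (2 * phi_j * norm2 (cg_r s) ^+ 2 + t).

End InexactCG.

(* Main.v *)
Require Import Defs.
From mathcomp Require Import ring lra spectral complex.
Set Implicit Arguments.
Unset Strict Implicit.
Unset Printing Implicit Defensive.

Import Order.TTheory GRing.Theory Num.Theory.
Local Open Scope ring_scope.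

(** Each step contributes [alpha_j *: (A + E_j) p_j] to the recurred residual
    but only [alpha_j *: A p_j] to the true one, so the two residuals differ by
    the sum of the vectors [- alpha_j *: E_j p_j] (lemma [residual_gap]). It is
    enough to bound the A^-1-norm of the j-th of them by a share 1/phi_{j+1} of
    the permitted gap (lemma [cg_perturbation_le]).

    Write P for the A-norm of p_j, and omega for the bound omega_j on E_j.
    Duality of the norms of A and of its inverse gives
    |p_j^T E_j p_j| <= omega P^2, hence p_j^T c_j >= (1 - omega) P^2 > 0 and
    |alpha_j| <= ||r_j||^2 / ((1 - omega) P^2). The perturbation therefore has
    A^-1-norm at most ||r_j||^2 / P * omega / (1 - omega), and omega_j is the
    value for which this is exactly the share wanted.

    With x' the minimizer of q, q(x) - q(x') = 1/2 ||r(x)||^2 and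
    q(x') = - 1/2 ||b||^2 in the A^-1-norm (lemmas [quad_sub_xstar] and
    [quad_xstar]). The claim on [quad] follows, because the triangle inequality
    bounds ||r(x_k)|| by sqrt eps ||b||.

    All this uses the weighted norms through their squares [x^T M x], so that a
    positive definite matrix M must be shown to have a positive definite square
    root (lemma [spd_sqrt_exists]). A real symmetric matrix is annihilated by
    every polynomial that vanishes at its eigenvalues, as diagonalisation over
    the complex numbers shows. So if the real polynomial p takes the value
    a^(1/4) at each eigenvalue a, then T := p(M) is real and symmetric with
    T^4 = M, and T^2 is the root. Taking fourth roots makes positivity
    immediate: x^T T^2 x is the squared length of T x. *)

(** * The Euclidean inner product *)

Section InnerProduct.
Context {R : realType} {n : nat}.
Implicit Types (u v w x : 'cV[R]_n) (M B : 'M[R]_n) (a : R).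

Lemma dotvE u v : dotv u v = \sum_i u i 0 * v i 0.
Proof. by rewrite /dotv mxE; apply: eq_bigr => i _; rewrite mxE. Qed.

Lemma dotvC u v : dotv u v = dotv v u.
Proof. by rewrite !dotvE; apply: eq_bigr => i _; rewrite mulrC. Qed.

Lemma dotvDr u v w : dotv u (v + w) = dotv u v + dotv u w.
Proof. by rewrite /dotv mulmxDr mxE. Qed.

Lemma dotvZr a u v : dotv u (a *: v) = a * dotv u v.
Proof. by rewrite /dotv -scalemxAr mxE. Qed.

Lemma dotvNr u v : dotv u (- v) = - dotv u v.
Proof. by rewrite -scaleN1r dotvZr mulN1r. Qed.

Lemma dotvDl u v w : dotv (u + v) w = dotv u w + dotv v w.
Proof. by rewrite dotvC dotvDr !(dotvC w). Qed.

Lemma dotvZl a u v : dotv (a *: u) v = a * dotv u v.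
Proof. by rewrite dotvC dotvZr dotvC. Qed.

Lemma dotvNl u v : dotv (- u) v = - dotv u v.
Proof. by rewrite dotvC dotvNr dotvC. Qed.

Lemma dotv_mulmxl M u v : dotv (M *m u) v = dotv u (M^T *m v).
Proof. by rewrite /dotv trmx_mul mulmxA. Qed.

Lemma dotv_ge0 u : 0 <= dotv u u.
Proof. by rewrite dotvE; apply: sumr_ge0 => i _; rewrite -expr2 sqr_ge0. Qed.

Lemma dotv_eq0 u : (dotv u u == 0) = (u == 0).
Proof.
apply/eqP/eqP => [|->]; last by rewrite /dotv mulmx0 mxE.
rewrite dotvE => /eqP; rewrite psumr_eq0 => [/allP u0|i _]; last first.
  by rewrite -expr2 sqr_ge0.
apply/colP => i; rewrite mxE; apply/eqP.
by have := u0 i (mem_index_enum i); rewrite /= mulf_eq0 orbb.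
Qed.

Lemma dotv_gt0 u : u != 0 -> 0 < dotv u u.
Proof. by rewrite lt0r dotv_eq0 dotv_ge0 => ->. Qed.

Lemma norm2_ge0 u : 0 <= norm2 u.
Proof. exact: sqrtr_ge0. Qed.

Lemma sqr_norm2 u : norm2 u ^+ 2 = dotv u u.
Proof. by rewrite /norm2 sqr_sqrtr ?dotv_ge0. Qed.

Lemma norm2_eq0 u : (norm2 u == 0) = (u == 0).
Proof. by rewrite -sqrf_eq0 sqr_norm2 dotv_eq0. Qed.

Lemma norm2Z a u : norm2 (a *: u) = `|a| * norm2 u.
Proof.
by rewrite /norm2 dotvZl dotvZr mulrA -expr2 sqrtrM ?sqr_ge0// sqrtr_sqr.
Qed.

(** The squared length of [dotv v v *: u - dotv u v *: v], a multiple of the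
    component of [u] orthogonal to [v], is nonnegative. *)
Lemma cauchy_schwarz u v : `|dotv u v| <= norm2 u * norm2 v.
Proof.
rewrite -(@ler_pXn2r _ 2) ?nnegrE ?mulr_ge0 ?norm2_ge0 //.
rewrite exprMn !sqr_norm2 real_normK ?num_real //.
have [->|v0] := eqVneq v 0.
  by rewrite /dotv !mulmx0 !mxE expr0n mulr0.
rewrite -(ler_pM2r (dotv_gt0 v0)) -subr_ge0.
have := dotv_ge0 (dotv v v *: u - dotv u v *: v).
rewrite !(dotvDl, dotvDr, dotvNl, dotvNr, dotvZl, dotvZr) (dotvC v u).
by congr (0 <= _); ring.
Qed.

Lemma ler_norm2D u v : norm2 (u + v) <= norm2 u + norm2 v.
Proof.
rewrite -(@ler_pXn2r _ 2) ?nnegrE ?addr_ge0 ?norm2_ge0 //.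
rewrite sqr_norm2 !(dotvDl, dotvDr) (dotvC v u) sqrrD !sqr_norm2.
have := le_trans (ler_norm _) (cauchy_schwarz u v).
rewrite mulr2n; lra.
Qed.

(** The Frobenius norm of [B] can serve as [C], by Cauchy-Schwarz on each row.
    This is what makes the suprema in [opnorm] finite. *)
Lemma norm2_mulmx_bounded B : exists C, forall x, norm2 (B *m x) <= C * norm2 x.
Proof.
pose F := \sum_i dotv (row i B)^T (row i B)^T.
have F_ge0 : 0 <= F by apply: sumr_ge0 => i _; exact: dotv_ge0.
exists (Num.sqrt F) => x.
rewrite -(@ler_pXn2r _ 2) ?nnegrE ?mulr_ge0 ?norm2_ge0 ?sqrtr_ge0 //.
rewrite exprMn sqr_norm2 (@sqr_sqrtr _ F) // dotvE mulr_suml; apply: ler_sum => i _.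
have -> : (B *m x) i 0 = dotv (row i B)^T x.
  by rewrite dotvE mxE; apply: eq_bigr => j _; rewrite !mxE.
rewrite -expr2 -[leLHS]real_normK ?num_real // -(sqr_norm2 (row i B)^T) -exprMn.
by rewrite ler_pXn2r ?nnegrE ?mulr_ge0 ?norm2_ge0 // cauchy_schwarz.
Qed.

End InnerProduct.

(** * Square roots of positive definite matrices *)

Section SquareRoot.
Context {R : realType}.
Local Notation toC := (real_complex R).

Lemma spd_sym n (M : 'M[R]_n) : spd M -> M^T = M.
Proof. by case. Qed.

Lemma spd_unitmx n (M : 'M[R]_n) : spd M -> M \in unitmx.
Proof.
case=> _ Mpos; rewrite -unitmx_tr -row_free_unit -kermx_eq0.
apply/negPn/negP => /rowV0Pn[v /sub_kermxP vM /negP v0].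
have x0 : v^T != 0 by apply/negP; rewrite -[0]trmx0 (inj_eq trmx_inj).
have := Mpos _ x0; rewrite -[M]trmxK -trmx_mul vM trmx0.
by rewrite /dotv mulmx0 mxE ltxx.
Qed.

Lemma spd_invmx n (M : 'M[R]_n) : spd M -> spd (invmx M).
Proof.
move=> Mspd; have Mu := spd_unitmx Mspd; have Mt := spd_sym Mspd.
split=> [|x x0]; first by rewrite trmx_inv Mt.
have y0 : invmx M *m x != 0.
  by apply: contra_neq x0 => /(congr1 (mulmx M)); rewrite mulKVmx // mulmx0.
by have := Mspd.2 _ y0; rewrite mulKVmx // dotvC.
Qed.

(** The easy converse of the existence of square roots. Invertibility of [T]
    suffices, which avoids discussing the signs of its eigenvalues. *)
Lemma spd_sqr n (T : 'M[R]_n) : T^T = T -> T \in unitmx -> spd (T *m T).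
Proof.
move=> Tt Tu; split=> [|x x0]; first by rewrite trmx_mul Tt.
rewrite -mulmxA -{1}Tt -dotv_mulmxl; apply: dotv_gt0.
by apply: contra_neq x0 => /(congr1 (mulmx (invmx T))); rewrite mulKmx // mulmx0.
Qed.

Lemma eigenvalue_spd_gt0 n (M : 'M[R]_n) a : spd M -> eigenvalue M a -> 0 < a.
Proof.
move=> [Mt Mpos] /eigenvalueP[v vM v0].
have x0 : v^T != 0 by rewrite -[0]trmx0 (inj_eq trmx_inj).
have := Mpos _ x0; rewrite -{1}Mt -trmx_mul vM linearZ /= dotvZr.
by rewrite pmulr_lgt0 // dotv_gt0.
Qed.

(** Newton interpolation: a new node is served by adding a multiple of the
    polynomial that vanishes at the previous ones. *)
Lemma interpolation (f : R -> R) (s : seq R) :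
  exists p : {poly R}, {in s, forall x, p.[x] = f x}.
Proof.
elim: s => [|y s [p pf]]; first by exists 0.
have [ys|ys] := boolP (y \in s).
  by exists p => x; rewrite in_cons => /orP[/eqP->|]; apply: pf.
pose w := \prod_(z <- s) ('X - z%:P).
have wy : w.[y] != 0 by rewrite -[_ == 0]/(root w y) root_prod_XsubC.
exists (p + ((f y - p.[y]) / w.[y]) *: w) => x.
rewrite in_cons hornerD hornerZ => /orP[/eqP->|xs].
  by rewrite divfK // addrC subrK.
have /eqP-> : w.[x] == 0 by rewrite -[_ == 0]/(root w x) root_prod_XsubC.
by rewrite mulr0 addr0 pf.
Qed.

Lemma trmx_horner_mx n (M : 'M[R]_n.+1) p :
  M^T = M -> (horner_mx M p)^T = horner_mx M p.
Proof.
move=> Mt; elim/poly_ind: p => [|p c IH]; first by rewrite rmorph0 trmx0.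
rewrite rmorphD rmorphM /= horner_mx_X horner_mx_C linearD /= tr_scalar_mx.
congr (_ + _); rewrite -mulmxE trmx_mul IH Mt.
exact: comm_mx_horner.
Qed.

(** The part of the spectral theorem needed here, stated over the reals: the
    eigenvalues of a symmetric matrix are real, and its minimal polynomial has
    simple roots. Over the complex numbers the matrix is unitarily
    diagonalisable with real diagonal [d], and the evaluation of a real
    polynomial commutes with both the embedding and the change of basis. *)
Lemma horner_mx_sym_eq0 n (M : 'M[R]_n.+1) : M^T = M ->
  exists s : seq R, {in s, forall a, eigenvalue M a} /\
    forall p, {in s, forall a, p.[a] = 0} -> horner_mx M p = 0.
Proof.
move=> Mt; pose MC := map_mx toC M.
have Mreal : MC \is a mxOver Num.real.
  by apply/mxOverP => i j; rewrite mxE; apply/complex_realP; exists (M i j).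
have Msym : MC \is symmetricmx.
  by apply/is_hermitianmxP; rewrite expr0 scale1r map_mx_id // map_trmx Mt.
have /orthomx_spectralP := symmetric_normalmx Msym Mreal.
have /mxOverP := hermitian_spectral_diag_real (realsym_hermsym Msym Mreal).
have := spectral_unit MC.
set P := spectralmx MC; set d := spectral_diag MC => Pu dreal MCE.
pose l i := complex.Re (d 0 i).
have dE i : d 0 i = toC (l i) by rewrite /l RRe_real ?dreal.
exists (codom l); split=> [a /codomP[i ->]|p p0].
  (* A real root of the complex characteristic polynomial is a root of the
     real one, hence has a real eigenvector. *)
  rewrite eigenvalue_root_char -(fmorph_root toC) map_char_poly.
  rewrite -eigenvalue_root_char; apply/eigenvalueP; exists (row i P).
    rewrite -/MC {1}MCE !mulmxA -row_mul mulmxV // row1 -rowE row_diag_mx.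
    by rewrite -scalemxAl -rowE dE.
  apply/eqP => Pi0; have := congr1 (row i) (mulmxV Pu).
  rewrite row_mul Pi0 mul0mx => /rowP/(_ i)/eqP.
  by rewrite !mxE eqxx eq_sym oner_eq0.
apply: (@map_mx_inj _ _ toC).
rewrite map_horner_mx -/MC MCE horner_mx_uconjC // horner_mx_diag.
suff -> : map_mx (horner (map_poly toC p)) d = 0.
  by rewrite linear0 mulmx0 mul0mx map_mx0.
by apply/rowP => i; rewrite !mxE dE horner_map p0 ?rmorph0 ?codom_f.
Qed.

(** The root is the square of [T := p(M)], where [p] interpolates the fourth
    root at the eigenvalues: [p ^+ 4 - 'X] vanishes there, so [T] is a symmetric
    fourth root of [M]. *)
Lemma spd_sqrt_exists n (M : 'M[R]_n) : spd M ->
  exists S : 'M[R]_n, spd S /\ S *m S = M.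
Proof.
(* Polynomials are evaluated at matrices of positive size only. *)
case: n M => [|n] M Mspd.
  by exists M; split=> //; apply/matrixP => [[]].
have [s [sM s0]] := horner_mx_sym_eq0 (spd_sym Mspd).
have [p pE] := interpolation (fun a => Num.sqrt (Num.sqrt a)) s.
pose T := horner_mx M p.
have T4 : T *m T *m (T *m T) = M.
  apply/eqP; rewrite -subr_eq0 -{1}(horner_mx_X M) /T !mulmxE -!rmorphM -rmorphB /=.
  apply/eqP/s0 => a sa; rewrite hornerD hornerN hornerX !hornerM pE //.
  have a_gt0 := eigenvalue_spd_gt0 Mspd (sM _ sa).
  by rewrite -!expr2 !sqr_sqrtr ?sqrtr_ge0 ?subrr // ltW.
exists (T *m T); split=> //; apply: spd_sqr.
  exact: trmx_horner_mx (spd_sym Mspd).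
have := spd_unitmx Mspd; rewrite -T4 -mulmxA unitmx_mul.
by case/andP.
Qed.

End SquareRoot.

(** * Weighted norms and the operator norm they induce *)

Section WeightedNorm.
Context {R : realType} {n : nat}.
Implicit Types (M N B E : 'M[R]_n) (u v x : 'cV[R]_n) (a : R).

Lemma sqrtmxP M : spd M -> spd (sqrtmx M) /\ sqrtmx M *m sqrtmx M = M.
Proof. by move=> /spd_sqrt_exists/xgetPex-/(_ 0). Qed.

Lemma sqrtmx_unit M : spd M -> sqrtmx M \in unitmx.
Proof. by move=> /sqrtmxP[/spd_unitmx]. Qed.

Lemma wnorm_ge0 M x : 0 <= wnorm M x.
Proof. exact: norm2_ge0. Qed.

Lemma sqr_wnorm M x : spd M -> wnorm M x ^+ 2 = dotv x (M *m x).
Proof.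
move=> /sqrtmxP[Sspd SS].
by rewrite /wnorm sqr_norm2 dotv_mulmxl (spd_sym Sspd) mulmxA SS.
Qed.

Lemma wnorm0 M : wnorm M 0 = 0.
Proof. by apply/eqP; rewrite /wnorm mulmx0 norm2_eq0. Qed.

Lemma wnorm_gt0 M x : spd M -> x != 0 -> 0 < wnorm M x.
Proof.
move=> Mspd x0; rewrite lt0r wnorm_ge0 andbT -sqrf_eq0 sqr_wnorm //.
by rewrite gt_eqF //; apply: Mspd.2.
Qed.

Lemma wnormZ M a x : wnorm M (a *: x) = `|a| * wnorm M x.
Proof. by rewrite /wnorm -scalemxAr norm2Z. Qed.

Lemma wnormN M x : wnorm M (- x) = wnorm M x.
Proof. by rewrite -scaleN1r wnormZ normrN1 mul1r. Qed.

Lemma ler_wnormD M u v : wnorm M (u + v) <= wnorm M u + wnorm M v.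
Proof. by rewrite /wnorm mulmxDr ler_norm2D. Qed.

Lemma ler_wnorm_sum M k (F : 'I_k -> 'cV[R]_n) :
  wnorm M (\sum_i F i) <= \sum_i wnorm M (F i).
Proof.
elim/big_ind2: _ => [|x a y c xa yc|//]; first by rewrite wnorm0.
exact: le_trans (ler_wnormD _ _ _) (lerD xa yc).
Qed.

(** The root of the inverse is the inverse of the root; stating this
    for norms avoids the uniqueness of positive definite roots. *)
Lemma wnorm_invmx M v :
  spd M -> wnorm (invmx M) v = norm2 (invmx (sqrtmx M) *m v).
Proof.
move=> Mspd; apply/eqP; rewrite -(@eqrXn2 _ 2) ?norm2_ge0 ?wnorm_ge0 //.
rewrite (sqr_wnorm v (spd_invmx Mspd)) sqr_norm2 dotv_mulmxl mulmxA.
have [Sspd SS] := sqrtmxP Mspd; have Su := sqrtmx_unit Mspd.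
rewrite trmx_inv (spd_sym Sspd); apply/eqP; congr (dotv v (_ *m v)).
apply: (can_inj (mulKmx (spd_unitmx Mspd))); rewrite mulmxV ?spd_unitmx //.
by rewrite -{1}SS -mulmxA mulKVmx // mulmxV.
Qed.

(** The norms of [M] and of its inverse are dual to each other: the two square
    roots cancel in the inner product. *)
Lemma dotv_le_wnorm M u v :
  spd M -> `|dotv u v| <= wnorm M u * wnorm (invmx M) v.
Proof.
move=> Mspd; rewrite wnorm_invmx //.
have [[St _] _] := sqrtmxP Mspd.
have -> : dotv u v = dotv (sqrtmx M *m u) (invmx (sqrtmx M) *m v).
  by rewrite dotv_mulmxl St mulKVmx // sqrtmx_unit.
exact: cauchy_schwarz.
Qed.

(** The supremum bounds each quotient because the quotients are bounded: as
    functions of [sqrtmx M *m x] they are Euclidean ones, for the matrix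
    [sqrtmx N *m E *m invmx (sqrtmx M)]. *)
Lemma wnorm_mulmx_le_opnorm N M E x :
  spd M -> wnorm N (E *m x) <= opnorm N M E * wnorm M x.
Proof.
move=> Mspd; have [->|x0] := eqVneq x 0; first by rewrite mulmx0 !wnorm0 mulr0.
rewrite -ler_pdivrMr ?wnorm_gt0 //; apply: ub_le_sup; last by exists x.
have [C CP] := norm2_mulmx_bounded (sqrtmx N *m E *m invmx (sqrtmx M)).
exists C => _ [y /= y0 <-]; rewrite ler_pdivrMr ?wnorm_gt0 //.
have := CP (sqrtmx M *m y).
by rewrite -!mulmxA mulKmx ?sqrtmx_unit.
Qed.

End WeightedNorm.

(** * The perturbed iteration *)

Section InexactCGBounds.
Context {R : realType} {n : nat}.
Variables (A : 'M[R]_n) (b : 'cV[R]_n) (E : nat -> 'M[R]_n).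
Hypothesis A_spd : spd A.

Definition cg_alpha (Ej : 'M[R]_n) (s : cg_state) : R :=
  cg_beta s / dotv (cg_p s) (cg_c A Ej s).

(** Both residuals start at [- b], and the [A]-parts of their updates agree. *)
Lemma residual_gap k :
  residual A b (cg_x (icg A b E k)) - cg_r (icg A b E k) =
  - \sum_(j < k) cg_alpha (E j) (icg A b E j) *: (E j *m cg_p (icg A b E j)).
Proof.
elim: k => [|k IH].
  by rewrite big_ord0 /residual /= mulmx0 sub0r subrr oppr0.
rewrite big_ord_recr /= [RHS]opprD -IH -!/(cg_alpha _ _) /cg_c /residual.
rewrite mulmxDr -scalemxAr mulmxDl scalerDr (addrAC (A *m _)) [- (cg_r _ + _)]opprD.
by rewrite addrACA [X in _ + (_ + X)]opprD addNKr.
Qed.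

Lemma cg_betaE k : cg_beta (icg A b E k) = norm2 (cg_r (icg A b E k)) ^+ 2.
Proof.
by case: k => [|k] /=; rewrite sqr_norm2 // sqr_norm2 dotvNl dotvNr opprK.
Qed.

(** One step uses up at most the fraction [phi_j^-1] of the permitted gap: the
    bound on [Ej] limits both the length of [Ej *m cg_p s] and the loss of
    curvature in the denominator of the step length. *)
Lemma cg_perturbation_le (eps phi_j : R) (Ej : 'M[R]_n) (s : cg_state) :
  0 < phi_j -> cg_beta s = norm2 (cg_r s) ^+ 2 -> cg_beta s != 0 ->
  dotv (cg_p s) (cg_c A Ej s) != 0 ->
  opnorm (invmx A) A Ej <= omega A b eps phi_j s ->
  wnorm (invmx A) (cg_alpha Ej s *: (Ej *m cg_p s)) <=
    Num.sqrt eps / 2 * wnorm (invmx A) b * phi_j^-1.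
Proof.
rewrite /omega /cg_alpha wnormZ => phi_gt0 betaE beta0 pc0.
rewrite -betaE; have beta_gt0 : 0 < cg_beta s.
  by rewrite lt0r beta0 betaE sqr_ge0.
have p0 : cg_p s != 0.
  by apply: contra_neq pc0 => ->; rewrite /dotv trmx0 mul0mx mxE.
set p := cg_p s in pc0 p0 *; set beta := cg_beta s in beta_gt0 *.
set kappa := Num.sqrt eps * wnorm (invmx A) b.
have kappa_ge0 : 0 <= kappa by rewrite mulr_ge0 ?sqrtr_ge0 ?wnorm_ge0.
have P_gt0 := wnorm_gt0 A_spd p0; set P := wnorm A p in P_gt0 *.
set d := 2 * phi_j * beta + kappa * P.
have d_gt0 : 0 < d.
  by rewrite ltr_pwDl ?mulr_gt0 // mulr_ge0 // ltW.
move=> E_le.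
set e := wnorm (invmx A) (Ej *m p).
have e_le : e <= kappa * P / d * P.
  apply: le_trans (wnorm_mulmx_le_opnorm _ _ _ A_spd) _.
  by rewrite ler_pM2r.
have pEp : - (P * e) <= dotv p (Ej *m p).
  by have := dotv_le_wnorm p (Ej *m p) A_spd; rewrite ler_norml => /andP[].
have pcE : dotv p (cg_c A Ej s) = P ^+ 2 + dotv p (Ej *m p).
  by rewrite /cg_c mulmxDl dotvDr sqr_wnorm.
(* Here 1 - omega = 2 phi_j beta / d. *)
have pc_ge : P ^+ 2 * (2 * phi_j * beta) / d <= dotv p (cg_c A Ej s).
  rewrite pcE; apply: le_trans (lerD (lexx _) pEp).
  have -> : P ^+ 2 * (2 * phi_j * beta) / d = P ^+ 2 - P * (kappa * P / d * P).
    by rewrite /d; field; rewrite gt_eqF.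
  by rewrite lerD2l lerN2 ler_pM2l.
have pc_gt0 : 0 < dotv p (cg_c A Ej s).
  by apply: lt_le_trans pc_ge; rewrite !mulr_gt0 ?invr_gt0 ?exprn_gt0.
rewrite (ger0_norm (divr_ge0 (ltW beta_gt0) (ltW pc_gt0))).
have -> : Num.sqrt eps / 2 * wnorm (invmx A) b / phi_j = kappa / (2 * phi_j).
  by rewrite /kappa; field; rewrite gt_eqF.
rewrite ler_pdivlMr ?mulr_gt0 // mulrAC -mulrA [leLHS]mulrAC ler_pdivrMr //.
apply: le_trans (ler_wpM2l kappa_ge0 pc_ge).
have -> : kappa * (P ^+ 2 * (2 * phi_j * beta) / d) =
  beta * (2 * phi_j) * (kappa * P / d * P) by field; rewrite gt_eqF.
by rewrite mulrA ler_pM2l ?mulr_gt0.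
Qed.

Lemma quad_xstar : quad A b (xstar A b) = - (2^-1 * wnorm (invmx A) b ^+ 2).
Proof.
rewrite (sqr_wnorm _ (spd_invmx A_spd)) /quad /xstar mulKVmx ?spd_unitmx //.
by rewrite (dotvC _ b); field.
Qed.

Lemma quad_sub_xstar x :
  quad A b x - quad A b (xstar A b) =
  2^-1 * wnorm (invmx A) (residual A b x) ^+ 2.
Proof.
rewrite quad_xstar opprK !(sqr_wnorm _ (spd_invmx A_spd)) /quad /residual.
rewrite mulmxBr mulKmx ?spd_unitmx // dotvDl !dotvDr !dotvNl !dotvNr.
rewrite (dotvC (A *m x)) dotv_mulmxl (spd_sym A_spd) mulKVmx ?spd_unitmx //.
by rewrite (dotvC x b); field.
Qed.

End InexactCGBounds.

(* Only E 0, ..., E (k - 1) matter; the entry phi 0 j is phi_{j+1}. *)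
Theorem theorem2p3 (R : realType) (n k : nat)
  (A : 'M[R]_n) (b : 'cV[R]_n) (E : nat -> 'M[R]_n)
  (eps : R) (phi : 'rV[R]_k)
  (A_spd : spd A)
  (runs : cg_runs A b E k)
  (eps_gt0 : 0 < eps)
  (phi_gt0 : forall j : 'I_k, 0 < phi 0 j)
  (phi_sum : \sum_(j < k) (phi 0 j)^-1 <= 1)
  (E_le : forall j : 'I_k,
     opnorm (invmx A) A (E j) <= omega A b eps (phi 0 j) (icg A b E j)) :
  let xk := cg_x (icg A b E k) in
  let rk := cg_r (icg A b E k) in
  let bound := Num.sqrt eps / 2 * wnorm (invmx A) b in
  wnorm (invmx A) (residual A b xk - rk) <= bound /\
  (wnorm (invmx A) rk <= bound ->
   Num.max (wnorm (invmx A) (residual A b xk - rk)) (wnorm (invmx A) rk)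
     <= bound /\
   `|quad A b xk - quad A b (xstar A b)| <= eps * `|quad A b (xstar A b)|).
Proof.
move=> xk rk bound.
have gap : wnorm (invmx A) (residual A b xk - rk) <= bound.
  rewrite residual_gap wnormN; apply: le_trans (ler_wnorm_sum _ _) _.
  apply: le_trans (_ : \sum_(j < k) bound * (phi 0 j)^-1 <= _).
    apply: ler_sum => j _; have [beta0 pc0] := runs j (ltn_ord j).
    exact: cg_perturbation_le (phi_gt0 j) (cg_betaE _ _ _ _) beta0 pc0 (E_le j).
  by rewrite -mulr_sumr ler_piMr // mulr_ge0 ?wnorm_ge0 // divr_ge0 ?sqrtr_ge0.
split=> // rk_le; split; first by rewrite ge_max gap rk_le.
have half_gt0 : (0 : R) < 2^-1 by rewrite invr_gt0.
rewrite quad_sub_xstar // quad_xstar // normrN.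
rewrite !(ger0_norm (mulr_ge0 (ltW half_gt0) (sqr_ge0 _))).
rewrite [leRHS]mulrCA ler_pM2l // -(sqr_sqrtr (ltW eps_gt0)) -exprMn.
rewrite ler_pXn2r ?nnegrE ?wnorm_ge0 ?mulr_ge0 ?sqrtr_ge0 ?wnorm_ge0 //.
rewrite -[residual A b xk](subrK rk); apply: le_trans (ler_wnormD _ _ _) _.
by apply: le_trans (lerD gap rk_le) _; rewrite /bound; lra.
Qed.
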